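(* Let $p \neq 2$ be a prime and let $e \ge 1$ be an integer. For each integer $j \geq 1$ let $|C_j|$ denote the number of pairs $(h,a)$ with $h, a \in \{1, 2, \ldots, p^j(p-1)\}$, $p \nmid h$, $p \nmid a$, and $h^h \equiv a^a \pmod{p^j}$. Then there are exactly $$|C_e| = p^{e-1}\,|C_1|$$ collisions that are solutions to the congruence $h^h \equiv a^a \pmod{p^e}$ for $(h,a)$ such that $h, a \in \{1, 2, \ldots, p^e(p-1)\}$, $p \nmid h$, $p \nmid a$. *)

(* Defs.v *)
From mathcomp Require Import all_boot.

Set Implicit Arguments.
Unset Strict Implicit.
Unset Printing Implicit Defensive.

(* The ordinal type is {0, ..., p ^ j * (p - 1)}; the value 0, which is outside
   the range of h and a, is excluded by the positivity conditions. *)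
Definition collisions (p j : nat) :
    {set 'I_(p ^ j * (p - 1)).+1 * 'I_(p ^ j * (p - 1)).+1} :=
  [set ha : 'I_(p ^ j * (p - 1)).+1 * 'I_(p ^ j * (p - 1)).+1 |
    [&& 0 < ha.1, 0 < ha.2, ~~ (p %| ha.1), ~~ (p %| ha.2)
      & ha.1 ^ ha.1 == ha.2 ^ ha.2 %[mod p ^ j]]].

(* Main.v *)
Require Import Defs.
From mathcomp Require Import all_boot cyclic.

Set Implicit Arguments.
Unset Strict Implicit.
Unset Printing Implicit Defensive.

(** The number of collisions is multiplied by [p] when the level [e >= 1] is
    raised by one; the formula follows by induction from [e = 1].

    Put [M = p ^ e * (p - 1)], so that the range of level [e.+1] consists of
    [p] consecutive blocks of length [M].  Since [M] is the order of the unit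
    group modulo [p ^ e.+1] and its square is divisible by [p ^ e.+1], every
    [a] prime to [p] satisfies
      [(a + t * M) ^ (a + t * M) = a ^ a * (1 + t * M)  mod p ^ e.+1]
    ([self_pow_lift]).  This has two consequences.
    - Modulo [p ^ e] the self-power map has period [M] on the integers prime to
      [p] ([self_pow_period]).
    - A solution [a] of [a ^ a = x] modulo [p ^ e] has exactly one lift
      [a + t * M] with [t < p] that solves it modulo [p ^ e.+1].  The condition
      on [t] is affine modulo [p], with slope [(p - 1) * a ^ a], a unit
      ([affine_solution_count]).  Hence for each [x] the number of solutions is
      the same at both levels ([self_roots_lift]).

    Counting collisions as the sum over [h] of the number of solutions [a] of
    [a ^ a = h ^ h], the inner count is unchanged from level [e] to level
    [e.+1] and is periodic in [h], while the range of [h] becomes [p] times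
    longer. *)

Lemma eqn_mod_mul2l c m n d : coprime c d ->
  (c * m == c * n %[mod d]) = (m == n %[mod d]).
Proof.
move=> co_cd; wlog le_nm : m n / n <= m.
  by move=> IH; case/orP: (leq_total n m) => /IH //; rewrite eq_sym => ->;
     rewrite eq_sym.
rewrite !eqn_mod_dvd ?leq_mul2l ?le_nm ?orbT //.
by rewrite -mulnBr Gauss_dvdr // coprime_sym.
Qed.

(** [t] runs over a complete residue system modulo [p], so multiplying by a unit
    [b] hits each residue once; this is the source of the uniqueness of lifts. *)
Lemma linear_solution_count p b c : 0 < p -> coprime b p ->
  \sum_(0 <= t < p) (c == t * b %[mod p]) = 1.
Proof.
move=> p_gt0 co_bp; rewrite big_mkord.
have inj_f : injective (fun t : 'I_p => Ordinal (ltn_pmod (t * b) p_gt0)).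
  move=> s t /(congr1 val) /= /eqP.
  by rewrite ![_ * b]mulnC eqn_mod_mul2l // !modn_small // => /eqP /val_inj.
rewrite -[RHS](_ : \sum_(t < p) (Ordinal (ltn_pmod c p_gt0) == t) = 1).
  rewrite [RHS](reindex_inj inj_f) /=.
  by apply: eq_bigr => t _; rewrite -val_eqE.
rewrite (bigD1 (Ordinal (ltn_pmod c p_gt0))) //= eqxx big1 ?addn0 // => t.
by rewrite eq_sym => /negbTE ->.
Qed.

(** If [x = u + q * c], the factor [q] cancels and leaves the linear condition
    [c = t * b] modulo [p]; otherwise no [t] can work, since every
    [u + q * (t * b)] is congruent to [u] modulo [q]. *)
Lemma affine_solution_count p q b u x : 0 < p -> 0 < q -> coprime b p ->
  \sum_(0 <= t < p) (x == u + q * (t * b) %[mod q * p]) = (x == u %[mod q]).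
Proof.
move=> p_gt0 q_gt0 co_bp.
(* Adding a multiple of the modulus makes the difference of [x] and [u] a
   natural number. *)
wlog le_ux : x / u <= x.
  move=> IH; have eq_q : u * (q * p) + x = x %[mod q].
    by rewrite (mulnC q) mulnA modnMDl.
  have := IH (u * (q * p) + x); rewrite eq_q => <-.
    by apply: eq_bigr => t _; rewrite modnMDl.
  by rewrite (leq_trans _ (leq_addr _ _)) // leq_pmulr // muln_gt0 q_gt0.
rewrite -(subnKC le_ux); set d := x - u.
rewrite -[u in RHS](addn0 u) -addnA add0n eqn_modDl mod0n.
have [/dvdnP [c ->] | ndvd] := boolP (q %| d).
  rewrite modnMl eqxx -[RHS](linear_solution_count c p_gt0 co_bp).
  apply: eq_bigr => t _.
  by rewrite mulnC eqn_modDl -!muln_modr eqn_pmul2l.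
rewrite -/(dvdn q d) (negbTE ndvd) big1 // => t _; rewrite eqn_modDl.
apply/eqP; rewrite eqb0; apply: contra ndvd => /eqP eq_d.
have: d = q * (t * b) %[mod q].
  by rewrite -(modn_dvdm d (dvdn_mulr p (dvdnn q))) eq_d modn_dvdm ?dvdn_mulr.
by rewrite /dvdn => ->; rewrite modnMr.
Qed.

(** The binomial expansion to first order in [x]; the factor [a] on the left
    keeps the exponent [n - 1] out of the statement. *)
Lemma pow_add_first_order d a x n : d %| x * x ->
  a * (a + x) ^ n = a ^ n * (a + n * x) %[mod d].
Proof.
move=> d_xx; elim: n => [|n IHn]; first by rewrite !expn0 mul0n addn0 mulnC.
rewrite expnSr mulnA -modnMml IHn modnMml expnSr.
have -> : a ^ n * (a + n * x) * (a + x)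
        = a ^ n * n * (x * x) + a ^ n * a * (a + n.+1 * x).
  rewrite -!mulnA -mulnDr; congr (_ * _).
  rewrite mulSn mulnDl !mulnDr (mulnC (n * x) a) -(mulnA n x x).
  by rewrite addnA addnC -addnA.
by case/dvdnP: d_xx => k ->; rewrite mulnA modnMDl.
Qed.

Section Lifting.

Variables (p e : nat).
Hypotheses (p_prime : prime p) (e_gt0 : 0 < e).

Let M := p ^ e * (p - 1).

Let coprime_pow a k : ~~ (p %| a) -> coprime a (p ^ k).
Proof.
by move=> ndvd_pa; rewrite coprime_sym coprimeXl // prime_coprime.
Qed.

Let dvdn_range k : k <= e -> p ^ k %| M.
Proof. by move=> le_ke; rewrite dvdn_mulr // dvdn_exp2l. Qed.

Let ndvdn_shift a t : (p %| t * M + a) = (p %| a).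
Proof. by rewrite dvdn_addr // dvdn_mull // (dvdn_range e_gt0). Qed.

(** The exponent may be reduced modulo [M], the order of the unit group modulo
    [p ^ e.+1]; the base is then expanded to first order.  The exponent [a] that
    the expansion brings down absorbs the missing factor of [a ^ (a - 1)]. *)
Lemma self_pow_lift a t : ~~ (p %| a) ->
  (t * M + a) ^ (t * M + a) = a ^ a + p ^ e * (t * ((p - 1) * a ^ a))
    %[mod p ^ e.+1].
Proof.
move=> ndvd_pa; apply/eqP.
have co_a : coprime a (p ^ e.+1) by apply: coprime_pow.
have eq_totient : totient (p ^ e.+1) = M.
  by rewrite totient_pfactor // mulnC /M subn1.
have pow_M : (t * M + a) ^ M = 1 %[mod p ^ e.+1].
  rewrite -[X in _ ^ X]eq_totient; apply: Euler_exp_totient; apply: coprime_pow.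
  by rewrite ndvdn_shift.
rewrite expnD [t * M in X in _ ^ X]mulnC expnM -modnMml -modnXm pow_M modnXm.
(* Multiplication by the unit [a] puts the goal in the form of the first-order
   expansion. *)
rewrite exp1n modnMml mul1n -(eqn_mod_mul2l _ _ co_a) addnC; apply/eqP.
have dvd_sq : p ^ e.+1 %| t * M * (t * M).
  apply: (@dvdn_trans (p ^ (e + e))).
    by apply: dvdn_exp2l; rewrite -addn1 leq_add2l.
  by rewrite expnD dvdn_mul // dvdn_mull // dvdn_range.
rewrite pow_add_first_order //; congr (_ %% _).
have -> : p ^ e * (t * ((p - 1) * a ^ a)) = a ^ a * (t * M).
  by rewrite (mulnC (p - 1)) !(mulnCA _ (a ^ a)) (mulnCA (p ^ e)).
by rewrite !mulnDr (mulnC a (a ^ a)) (mulnCA a (a ^ a)).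
Qed.

Lemma self_pow_period h t : ~~ (p %| h) ->
  (t * M + h) ^ (t * M + h) = h ^ h %[mod p ^ e].
Proof.
move=> ndvd_ph.
rewrite -(modn_dvdm _ (dvdn_exp2l p (leqnSn e))) self_pow_lift //.
by rewrite modn_dvdm ?dvdn_exp2l // mulnC addnC modnMDl.
Qed.

End Lifting.

(** With [M] the upper summation bound, the range [0 .. M - 1] replaces
    [1 .. M]: both [0] and [M] are divisible by [p] when [e >= 1], and a range
    that starts at [0] splits into blocks that start at multiples of [M]. *)
Definition self_roots p e x :=
  \sum_(0 <= a < p ^ e * (p - 1)) (~~ (p %| a) && (x == a ^ a %[mod p ^ e])).

Lemma sum_blocks p M (F : nat -> nat) :
  \sum_(0 <= i < p * M) F i
    = \sum_(0 <= t < p) \sum_(0 <= a < M) F (t * M + a).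
Proof.
rewrite big_nat_mul; apply: eq_bigr => t _.
rewrite -{1}[t * M]add0n big_addn mulSn addnK.
by apply: eq_bigr => a _; rewrite addnC.
Qed.

(** Grouping the solutions at level [e.+1] by their residue [a] modulo the
    range of level [e], each [a] that solves the congruence modulo [p ^ e]
    contributes exactly one, and every other [a] none. *)
Lemma self_roots_lift p e x : prime p -> 0 < e ->
  self_roots p e.+1 x = self_roots p e x.
Proof.
move=> p_prime e_gt0; have p_gt0 := prime_gt0 p_prime.
rewrite /self_roots expnS -mulnA sum_blocks exchange_big /=.
apply: eq_bigr => a _.
have dvd_pM t : p %| t * (p ^ e * (p - 1)).
  by rewrite dvdn_mull // dvdn_mulr // dvdn_exp.
under eq_bigr => t _ do rewrite (dvdn_addr _ (dvd_pM t)).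
have [dvd_pa | ndvd_pa] /= := boolP (p %| a); first by rewrite big1.
have co_b : coprime ((p - 1) * a ^ a) p.
  rewrite coprimeMl subn1 coprime_sym coprimenP // coprimeXl //.
  by rewrite coprime_sym prime_coprime.
rewrite -(affine_solution_count (a ^ a) x p_gt0 _ co_b) ?expn_gt0 ?p_gt0 //.
by apply: eq_bigr => t _; rewrite -expnS self_pow_lift // -expnSr.
Qed.

Lemma card_collisions p e : 0 < e ->
  #|collisions p e|
    = \sum_(0 <= h < p ^ e * (p - 1) | ~~ (p %| h)) self_roots p e (h ^ h).
Proof.
move=> e_gt0; set M := p ^ e * (p - 1).
have dvd_pM : p %| M by rewrite dvdn_mulr // dvdn_exp.
have gt0 h : ~~ (p %| h) -> 0 < h by case: h => //; rewrite dvdn0.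
have drop_last (P : pred nat) (F : nat -> nat) : ~~ P M ->
  \sum_(h < M.+1 | P h) F h = \sum_(0 <= h < M | P h) F h.
  by move=> /negbTE PM; rewrite big_mkcond big_ord_recr /= PM addn0 -big_mkcond
     big_mkord.
rewrite -sum1dep_card.
rewrite -(drop_last _ (fun h => self_roots p e (h ^ h))) ?negbK //.
rewrite (eq_bigl (fun ha : 'I_M.+1 * 'I_M.+1 => ~~ (p %| ha.1) &&
   (~~ (p %| ha.2) && (ha.1 ^ ha.1 == ha.2 ^ ha.2 %[mod p ^ e])))).
  rewrite -(pair_big_dep (fun h : 'I_M.+1 => ~~ (p %| h)) (fun h a : 'I_M.+1 =>
    ~~ (p %| a) && (h ^ h == a ^ a %[mod p ^ e])) (fun _ _ => 1)) /=.
  apply: eq_bigr => h _; rewrite (drop_last (fun a => ~~ (p %| a) &&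
    (h ^ h == a ^ a %[mod p ^ e])) (fun=> 1)) ?dvd_pM // big_mkcond.
  by apply: eq_bigr => a _; case: ifP.
case=> h a /=; have [->|h_gt0] := posnP h; first by rewrite dvdn0.
have [->|a_gt0] := posnP a; first by rewrite dvdn0 !andbF.
by [].
Qed.

Lemma card_collisionsS p e : prime p -> 0 < e ->
  #|collisions p e.+1| = p * #|collisions p e|.
Proof.
move=> p_prime e_gt0; rewrite !card_collisions //.
rewrite big_mkcond expnS -mulnA sum_blocks.
rewrite -[X in _ = X * _]subn0 -sum_nat_const_nat.
apply: eq_bigr => t _.
rewrite [RHS]big_mkcond; apply: eq_bigr => h _.
rewrite dvdn_addr; last by rewrite dvdn_mull // dvdn_mulr // dvdn_exp.
have [// | ndvd_ph] := boolP (p %| h); rewrite /= self_roots_lift //.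
by apply: eq_bigr => a _; rewrite self_pow_period.
Qed.

Theorem corollary22 (p e : nat) (p_prime : prime p) (p_neq2 : p <> 2)
    (e_ge1 : 1 <= e) :
  #|collisions p e| = p ^ (e - 1) * #|collisions p 1|.
Proof.
case: e e_ge1 => // e _; rewrite subSS subn0.
elim: e => [|e IHe]; first by rewrite mul1n.
by rewrite card_collisionsS // IHe mulnA -expnS.
Qed.
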